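(* Let $e$ be an edge in a connected hypergraph $H=(V,E)$. The following are equivalent: (1) $e$ is a strong cut edge, that is, $\omega(H-e)=|e|$; (2) $e$ contains exactly one vertex from each connected component of $H-e$; (3) $e$ lies in no cycle of $H$.
   Context: A hypergraph $H=(V,E)$ consists of a nonempty finite vertex set $V$, a finite edge set $E$, and an incidence function $\psi:E\to 2^V$; edges are identified with their vertex sets (distinct edges may be parallel). Two distinct vertices are adjacent via $e$ if both lie in $e$; a walk is a sequence $v_0e_1v_1\dots e_kv_k$ with $v_{i-1},v_i$ adjacent via $e_i$; $H$ is connected if any two distinct vertices are joined by a walk. For an equivalence class $V'$ of ''joined by a walk'', the connected component is $(V',\{f\in E:\emptyset\ne f\subseteq V'\})$; $\omega(H)$ is the number of components. $H-e=(V,E\setminus\{e\})$. A cut edge is an edge $e$ with $\omega(H-e)>\omega(H)$; it is strong if $\omega(H-e)=\omega(H)+|e|-1$. A cycle is a walk $v_0e_1v_1\dots e_kv_k$ with $k\ge2$, $v_0=v_k$, the vertices $v_0,\dots,v_{k-1}$ pairwise distinct and the edges $e_1,\dots,e_k$ pairwise distinct; an edge lies in the cycle if it is one of the $e_i$.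
   Formalization: The edge e is assumed nonempty (for empty e, (3) holds but (1) and (2) fail); (1) is taken as ω(H−e)=|e|, and the literal strong cut edge condition is shown equivalent only for |e| ≥ 2, since an edge with |e|=1 is never a cut edge although (2) and (3) hold. *)

(* Defs.v *)
From HB Require Import structures.
From mathcomp Require Import all_boot.

Set Implicit Arguments.
Unset Strict Implicit.
Unset Printing Implicit Defensive.

(* The vertex set is all of V and the edge set all of E.  The incidence
   function need not be injective (parallel edges) and may take the value
   set0 (empty edges). *)
Record hypergraph (V E : finType) := Hypergraph {
  incidence :> E -> {set V};
  vertex_nonempty : 0 < #|V|
}.

Section Walks.
Variables (V E : finType) (H : hypergraph V E).

Definition adjacent_via (f : E) (u v : V) : bool :=
  [&& u != v, u \in H f & v \in H f].

(* The walk v_0 e_1 v_1 ... e_k v_k is encoded by its first vertex v_0 and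
   the sequence [:: (e_1, v_1); ...; (e_k, v_k)]; k = 0 is allowed. *)
Fixpoint is_walk (v0 : V) (w : seq (E * V)) : bool :=
  if w is (f, v) :: w' then adjacent_via f v0 v && is_walk v w' else true.

Definition walk_end (v0 : V) (w : seq (E * V)) : V := last v0 (unzip2 w).

Definition joined : rel V :=
  connect (fun u v => [exists f, adjacent_via f u v]).

Lemma joinedP (u v : V) :
  reflect (exists2 w, is_walk u w & walk_end u w = v) (joined u v).
Proof.
apply: (iffP connectP) => [[p]|[w]].
  elim: p u => [|x p IHp] u /=; first by move=> _ ->; exists [::].
  case/andP=> /existsP[f fux] /IHp{}IHp /IHp[w ww wv].
  by exists ((f, x) :: w) => //=; rewrite fux.
elim: w u => [|[f x] w IHw] u /=; first by move=> _ <-; exists [::].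
case/andP=> fux /IHw{}IHw /IHw[p pp pv].
by exists (x :: p) => //=; rewrite pp andbT; apply/existsP; exists f.
Qed.

Definition connected : Prop := forall u v : V, u != v -> joined u v.

(* The component with vertex set C, as a pair (vertex set, edge set). *)
Definition component (C : {set V}) : {set V} * {set E} :=
  (C, [set f | (H f != set0) && (H f \subset C)]).

Definition components : {set {set V} * {set E}} :=
  component @: equivalence_partition joined [set: V].

Definition omega : nat := #|components|.

(* belast drops v_k from the vertex sequence v_0, ..., v_k. *)
Definition is_cycle (v0 : V) (w : seq (E * V)) : bool :=
  [&& is_walk v0 w, 1 < size w, walk_end v0 w == v0,
      uniq (belast v0 (unzip2 w)) & uniq (unzip1 w)].

Definition lies_in_cycle (e : E) : Prop :=
  exists v0 w, is_cycle v0 w /\ e \in unzip1 w.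

End Walks.

Definition delete_edge (V E : finType) (H : hypergraph V E) (e : E) :
    hypergraph V {f : E | f != e} :=
  Hypergraph (fun f => H (val f)) (vertex_nonempty H).

Definition cut_edge (V E : finType) (H : hypergraph V E) (e : E) : Prop :=
  omega H < omega (delete_edge H e).

(* The truncated subtraction is harmless: omega H is positive. *)
Definition strong_cut_edge (V E : finType) (H : hypergraph V E) (e : E) :
    Prop :=
  cut_edge H e /\ omega (delete_edge H e) = omega H + #|H e| - 1.

Definition meets_each_component_once (V E : finType) (H : hypergraph V E)
    (e : E) : Prop :=
  forall K, K \in components (delete_edge H e) -> #|H e :&: K.1| = 1.

(* Main.v *)
Require Import Defs.
From HB Require Import structures.
From mathcomp Require Import all_boot.

Set Implicit Arguments.
Unset Strict Implicit.
Unset Printing Implicit Defensive.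

(** Since H is connected, every component of H - e meets e, so |e| is the sum
    over these components C of the positive numbers |e :&: C|; it equals the
    number of components iff each summand is 1.  This in turn means that no two
    distinct vertices of e are joined in H - e.  A cycle through e joins two such
    vertices once e is removed from it, and conversely a walk of H - e between
    them, shortened until its vertices and its edges are distinct, is closed up
    into a cycle by e. *)

Section Walks.
Variables (V E : finType) (H : hypergraph V E).

Lemma adjacent_via_sym (f : E) (u v : V) :
  adjacent_via H f u v = adjacent_via H f v u.
Proof. by rewrite /adjacent_via eq_sym [(u \in _) && _]andbC. Qed.

Lemma joined_sym : symmetric (joined H).
Proof.
apply: sym_connect_sym => u v.
by apply/eq_existsb => f; rewrite adjacent_via_sym.
Qed.

Lemma joined_equivalence : {in [set: V] & &, equivalence_rel (joined H)}.
Proof.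
move=> x y z _ _ _; split=> [|xy]; first exact: connect0.
exact: (same_connect joined_sym xy).
Qed.

Lemma adjacent_joined (f : E) (u v : V) : adjacent_via H f u v -> joined H u v.
Proof. by move=> fuv; apply: connect1; apply/existsP; exists f. Qed.

Lemma is_walk_cat (u : V) (w1 w2 : seq (E * V)) :
  is_walk H u (w1 ++ w2) = is_walk H u w1 && is_walk H (walk_end u w1) w2.
Proof. by elim: w1 u => [|[f v] w1 IHw] u //=; rewrite IHw andbA. Qed.

Lemma walk_end_cat (u : V) (w1 w2 : seq (E * V)) :
  walk_end u (w1 ++ w2) = walk_end (walk_end u w1) w2.
Proof. by rewrite /walk_end /unzip2 map_cat last_cat. Qed.

Lemma mem_unzip1_split (f : E) (w : seq (E * V)) :
  f \in unzip1 w -> exists w1 x w2, w = w1 ++ (f, x) :: w2.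
Proof.
by case/mapP=> -[g x] /path.splitPr[w1 w2] /= ->; exists w1, x, w2.
Qed.

Lemma mem_unzip2_split (x : V) (w : seq (E * V)) :
  x \in unzip2 w -> exists w1 f w2, w = w1 ++ (f, x) :: w2.
Proof.
by case/mapP=> -[f y] /path.splitPr[w1 w2] /= ->; exists w1, f, w2.
Qed.

(** Induction on the walk: its first step is put in front of a simple walk [w] from [x], and a
    repetition of [u] or of [f] is cut out. Edges need care of their own, since an edge with three
    or more vertices can recur in a walk with distinct vertices. *)
Lemma joined_simple_walk (u v : V) : joined H u v ->
  exists w, [/\ is_walk H u w, walk_end u w = v, uniq (u :: unzip2 w)
              & uniq (unzip1 w)].
Proof.
case/joinedP=> w; elim: w u => [|[f x] w IHw] u; first by move=> _ <-; exists [::].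
move=> /= /andP[fux ww] wv; have {w IHw ww wv} [w [ww wv Uv Ue]] := IHw x ww wv.
have [|uNw] := boolP (u \in unzip2 ((f, x) :: w)).
  rewrite /= inE; case/predU1P=> [-> | /mem_unzip2_split[w1 [g [w2 Dw]]]].
    by exists w.
  (* The walk [w] returns to [u], so the part after that visit is enough. *)
  exists w2; move: ww wv Uv Ue.
  rewrite Dw is_walk_cat walk_end_cat /unzip1 /unzip2 !map_cat /= !cat_uniq.
  case/andP=> _ /andP[_ ww2] wv /and4P[_ _ _ Uv] /and4P[_ _ _ Ue].
  by split.
have [/mem_unzip1_split[w1 [y [w2 Dw]]] | fNw] := boolP (f \in unzip1 w).
  (* The second use of f already reaches y from u. *)
  exists ((f, y) :: w2); move: ww wv Uv Ue uNw.
  rewrite Dw is_walk_cat walk_end_cat /unzip1 /unzip2 /= !map_cat /= !cat_uniq.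
  case/andP=> _ /andP[/and3P[_ _ yf] ww2] wv /and4P[_ _ _ Uv] /and3P[_ _ Ue].
  rewrite inE mem_cat => /norP[_ /norP[_ uNyw2]].
  split=> //=; last by rewrite uNyw2.
  rewrite in_cons in uNyw2; case/norP: uNyw2 => uNy _.
  by case/and3P: fux => _ uf _; rewrite ww2 andbT; apply/and3P.
exists ((f, x) :: w); split=> //=; [by rewrite fux | | by rewrite fNw].
by rewrite uNw.
Qed.

(** [component] is injective: its first coordinate is the class itself. *)
Lemma omegaE : omega H = #|equivalence_partition (joined H) [set: V]|.
Proof. by rewrite /omega card_imset // => A B []. Qed.

Lemma components_joinedP (K : {set V} * {set E}) :
  reflect (exists u, K = component H [set v | joined H u v])
          (K \in components H).
Proof.
have cls u : [set v in [set: V] | joined H u v] = [set v | joined H u v].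
  by apply/setP=> v; rewrite !inE.
apply: (iffP imsetP) => [[C /imsetP[u _ ->] ->] | [u ->]].
  by exists u; rewrite cls.
by exists [set v | joined H u v] => //; apply/imsetP; exists u; rewrite ?cls.
Qed.

Lemma connected_omega : connected H -> omega H = 1.
Proof.
move=> connH; have /card_gt0P[u _] := vertex_nonempty H.
have class_full v : [set x | joined H v x] = [set: V].
  apply/setP=> x; rewrite !inE; have [->|] := eqVneq v x; first exact: connect0.
  exact: connH.
rewrite /omega; apply/eqP/cards1P; exists (component H [set: V]).
apply/setP=> K; rewrite inE; apply/components_joinedP/eqP => [[v ->]|->].
  by rewrite class_full.
by exists u; rewrite class_full.
Qed.

End Walks.

Section DeleteEdge.
Variables (V E : finType) (H : hypergraph V E) (e : E).
Let H' := delete_edge H e.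

Lemma adjacent_joined_delete (f : E) (u v : V) :
  f != e -> adjacent_via H f u v -> joined H' u v.
Proof. by move=> fNe fuv; apply: (@adjacent_joined _ _ H' (Sub f fNe)). Qed.

Lemma walk_avoiding_joined (u : V) (w : seq (E * V)) :
  is_walk H u w -> e \notin unzip1 w -> joined H' u (walk_end u w).
Proof.
elim: w u => [|[f v] w IHw] u /=; first by move=> _ _; apply: connect0.
case/andP=> fuv ww; rewrite inE negb_or eq_sym => /andP[fNe eNw].
exact: connect_trans (adjacent_joined_delete fNe fuv) (IHw v ww eNw).
Qed.

Lemma walk_meets_edge (u : V) (w : seq (E * V)) :
  is_walk H u w -> walk_end u w \in H e ->
  exists2 x, x \in H e & joined H' u x.
Proof.
elim: w u => [|[f v] w IHw] u /=; first by exists u => //; apply: connect0.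
case/andP=> fuv ww we; have [Dfe | fNe] := eqVneq f e.
  by exists u; [move: fuv; rewrite Dfe => /and3P[] | apply: connect0].
have [x ex vx] := IHw v ww we; exists x => //.
exact: connect_trans (adjacent_joined_delete fNe fuv) vx.
Qed.

Definition lift_walk (w : seq ({f : E | f != e} * V)) : seq (E * V) :=
  [seq (val p.1, p.2) | p <- w].

Lemma is_walk_lift (u : V) (w : seq ({f : E | f != e} * V)) :
  is_walk H' u w -> is_walk H u (lift_walk w).
Proof. by elim: w u => [|[f v] w IHw] u //= /andP[fuv /IHw->]; rewrite andbT. Qed.

Lemma unzip2_lift (w : seq ({f : E | f != e} * V)) :
  unzip2 (lift_walk w) = unzip2 w.
Proof. by rewrite /unzip2 -map_comp. Qed.

Lemma unzip1_lift (w : seq ({f : E | f != e} * V)) :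
  unzip1 (lift_walk w) = map val (unzip1 w).
Proof. by rewrite /unzip1 -!map_comp. Qed.

Lemma cycle_joined : lies_in_cycle H e ->
  exists u v, [/\ u \in H e, v \in H e, u != v & joined H' u v].
Proof.
case=> v0 [w [/and5P[ww _ /eqP wv0 _ Ue] /mem_unzip1_split[w1 [x [w2 Dw]]]]].
move: ww wv0 Ue; rewrite {w}Dw is_walk_cat walk_end_cat /unzip1 map_cat /=.
case/and3P=> ww1 /and3P[uNx eu ex] ww2 wv0.
rewrite cat_uniq /= negb_or => /and3P[_ /andP[eNw1 _] /andP[eNw2 _]].
(* The rest of the cycle runs from [x] along [w2] to [v0], then along [w1]; it avoids [e] because
   the edges are distinct. *)
exists (walk_end v0 w1), x; split=> //; rewrite joined_sym.
apply: connect_trans (walk_avoiding_joined ww1 eNw1).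
by have := walk_avoiding_joined ww2 eNw2; rewrite [walk_end x w2]wv0.
Qed.

Lemma joined_cycle (u v : V) :
  u \in H e -> v \in H e -> u != v -> joined H' u v -> lies_in_cycle H e.
Proof.
move=> eu ev uNv /joined_simple_walk[w [ww wv Uv Ue]].
exists u, (rcons (lift_walk w) (e, u)); split; last first.
  by rewrite /unzip1 map_rcons mem_rcons mem_head.
rewrite /is_cycle -cats1 is_walk_cat is_walk_lift //= /walk_end cats1.
rewrite /unzip1 /unzip2 !map_rcons -/(unzip1 _) -/(unzip2 _) last_rcons eqxx.
(* [belast] drops the final return to [u], which leaves the vertices of the simple walk. *)
rewrite belast_rcons unzip2_lift unzip1_lift Uv rcons_uniq.
rewrite map_inj_uniq ?Ue; last exact: val_inj.
rewrite -/(walk_end u w) wv /adjacent_via eq_sym uNv eu ev size_rcons size_map.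
(* As [u != v], the walk has at least one step, so [e] makes the length at least 2. *)
case: w wv {ww Uv Ue} => [uv|p w _] /=; first by rewrite -uv eqxx in uNv.
rewrite -map_cons !andbT; apply/mapP=> -[f _ Df].
by have := valP f; rewrite /= -Df eqxx.
Qed.

Hypotheses (connH : connected H) (e_nonempty : H e != set0).

Lemma component_meets_edge (u : V) : exists2 x, x \in H e & joined H' u x.
Proof.
have /set0Pn[y ey] := e_nonempty; have [-> | uNy] := eqVneq u y.
  by exists y => //; apply: connect0.
have /joinedP[w ww wy] := connH uNy.
by apply: (walk_meets_edge ww); rewrite wy.
Qed.

(** Every component meets [e] by [component_meets_edge], so only uniqueness is at stake. *)
Lemma meets_onceP : meets_each_component_once H e <->
  {in H e &, forall u v, joined H' u v -> u = v}.
Proof.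
split=> [once u v eu ev uv | inj K /components_joinedP[u ->] /=].
  have /once/eqP/cards1P[x Dx] :
      component H' [set y | joined H' u y] \in components H'.
    by apply/components_joinedP; exists u.
  have mem y : y \in H e -> joined H' u y -> y = x.
    by move=> ey uy; apply/set1P; rewrite -Dx !inE ey.
  by rewrite (mem v ev uv); apply: mem eu (connect0 _ u).
have [x ex ux] := component_meets_edge u.
apply/eqP/cards1P; exists x; apply/setP=> y; rewrite !inE.
apply/andP/eqP => [[ey uy] | -> //]; apply: inj => //.
by apply: connect_trans ux; rewrite -/(joined _ _ _) joined_sym.
Qed.

Lemma omega_meets_once :
  omega H' = #|H e| <-> meets_each_component_once H e.
Proof.
pose P := equivalence_partition (joined H') [set: V].
have /and3P[/eqP coverP tiP _] : partition P [set: V].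
  exact/equivalence_partitionP/joined_equivalence.
have De : #|H e| = \sum_(C in P) #|H e :&: C|.
  rewrite -sum1_card (eq_bigl (fun x => (x \in cover P) && (x \in H e))).
    rewrite big_trivIset_cond //=; apply: eq_bigr => C _.
    by rewrite -sum1_card; apply: eq_bigl => x; rewrite inE andbC.
  by move=> x; rewrite coverP inE.
(* The left sum is the number of components; [?= iff] records that equality of the sums forces
   equality term by term. *)
have Dle : \sum_(C in P) 1 <= \sum_(C in P) #|H e :&: C|
    ?= iff [forall (C | C \in P), 1 == #|H e :&: C|].
  apply: leqif_sum => C /imsetP[u _ ->]; split=> //.
  have [x ex ux] := component_meets_edge u.
  by apply/card_gt0P; exists x; rewrite !inE ex.
have [_ eqP1] := Dle; rewrite omegaE -/P De -sum1_card.
split=> [/eqP | once].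
  rewrite eqP1 => /forall_inP one K /imsetP[C PC ->].
  by rewrite -(eqP (one C PC)).
apply/eqP; rewrite eqP1; apply/forall_inP=> C PC.
by rewrite (once (component H' C)) //; apply: imset_f.
Qed.

Lemma meets_once_no_cycle :
  meets_each_component_once H e <-> ~ lies_in_cycle H e.
Proof.
split=> [/meets_onceP inj /cycle_joined[u [v [eu ev /eqP uNv uv]]] | noc].
  by apply: uNv; apply: inj.
apply/meets_onceP.
move=> u v eu ev uv; have [//|uNv] := eqVneq u v.
by case: noc; apply: joined_cycle uv.
Qed.

(** Here [omega H = 1]. The bound on [#|H e|] supplies the cut edge condition: a one-vertex edge
    satisfies the equation on the right without being a cut edge. *)
Lemma strong_cut_edge_omega : 1 < #|H e| ->
  strong_cut_edge H e <-> omega H' = #|H e|.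
Proof.
move=> e_gt1; rewrite /strong_cut_edge /cut_edge connected_omega //.
rewrite addnC addnK -/H'; split=> [[] // | De].
by rewrite De.
Qed.

End DeleteEdge.

(** An empty edge lies in no cycle but meets no component, hence [e_nonempty]. *)
Theorem theorem3p18 (V E : finType) (H : hypergraph V E) (e : E)
    (connH : connected H) (e_nonempty : H e != set0) :
  [<-> omega (delete_edge H e) = #|H e|;
       meets_each_component_once H e;
       ~ lies_in_cycle H e]
  /\ (1 < #|H e| ->
      [<-> strong_cut_edge H e;
           meets_each_component_once H e;
           ~ lies_in_cycle H e]).
Proof.
have [omega_once once_omega] := omega_meets_once connH e_nonempty.
have [once_noc noc_once] := meets_once_no_cycle connH e_nonempty.
split=> [|e_gt1].
  by tfae=> // /noc_once/once_omega.
have [strong_omega omega_strong] := strong_cut_edge_omega connH e_gt1.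
by tfae=> // [/strong_omega/omega_once | /noc_once/once_omega/omega_strong].
Qed.
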